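(* Consider the nonholonomic particle system and its nonholonomic ODE $$\dot x=v_x,\quad \dot y=v_y,\quad \dot z=v_z,\quad \dot v_x=-\frac{y}{1+y^2}v_xv_y,\quad \dot v_y=0,\quad \dot v_z=\frac1{1+y^2}v_xv_y,$$ on $D^{np}=\{(q,v)\in\mathbb{R}^3\times\mathbb{R}^3: v_z-y\,v_x=0\}$, with multiplier $\lambda=\frac{v_xv_y}{1+y^2}$. Let $F^{nh}_{L_d}:D_d\to D_d$, $(q_{k-1},q_k)\mapsto(q_k,q_{k+1})$, $q_k=(x_k,y_k,z_k)$, be the discrete nonholonomic flow generated by $$\frac{x_{k+1}-2x_k+x_{k-1}}{\epsilon^2}=-\lambda_{k+1}y_k,\quad \frac{y_{k+1}-2y_k+y_{k-1}}{\epsilon^2}=0,\quad \frac{z_{k+1}-2z_k+z_{k-1}}{\epsilon^2}=\lambda_{k+1},$$ $$\frac{z_{k+1}-z_k}{\epsilon}-\frac{y_{k+1}+y_k}{2}\cdot\frac{x_{k+1}-x_k}{\epsilon}=0 .$$ (i) The velocity nonholonomic variational integrator $\tilde\rho\circ F^{nh}_{L_d}\circ\tilde\rho^{-1}$ defined by $\tilde\rho(q_k,q_{k+1})=\left(\frac{q_k+q_{k+1}}2,\frac{q_{k+1}-q_k}\epsilon\right)$ gives rise to a $(2,0)$ consistent discretization of the nonholonomic ODE, and moreover it preserves $D^{np}$. (ii) The velocity nonholonomic variational integrator $\hat\rho\circ F^{nh}_{L_d}\circ\hat\rho^{-1}$ defined by $\hat\rho(q_k,q_{k+1})=\left(q_{k+1},\frac{q_{k+1}-q_k}\epsilon\right)$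 gives rise to a $(1,0)$ consistent discretization that does not preserve the original nonholonomic distribution $D^{np}$ (the pairs it generates do not in general satisfy $v_z-y\,v_x=0$), but it does respect the perturbed constraint $$v_z-y\,v_x+\frac\epsilon2v_xv_y=0 .$$
   Context: The nonholonomic particle is the system on $Q=\mathbb{R}^3$ with Lagrangian $L=\frac12(\dot x^2+\dot y^2+\dot z^2)$ and constraint $\dot z-y\dot x=0$, i.e. given by the one-form $\mu=(-y,0,1)$. The step size is $\epsilon>0$ (small), and $D_d\subset\mathbb{R}^3\times\mathbb{R}^3$ is the set of pairs $(q_k,q_{k+1})$ satisfying $\frac{z_{k+1}-z_k}{\epsilon}-\frac{y_{k+1}+y_k}{2}\cdot\frac{x_{k+1}-x_k}{\epsilon}=0$. In (i), the integrator acts on $(\tilde q_k,v_k)=\tilde\rho(q_{k-1},q_k)$ with $(q_{k-1},q_k)\in D_d$; in (ii), on $(q_k,v_k)=\hat\rho(q_{k-1},q_k)$ with $(q_{k-1},q_k)\in D_d$. A map preserves (respects) a constraint set if it maps points of that set to points of that set. $(p,s)$ consistent discretization: writing $(q_k,v_k)\mapsto(q_{k+1},v_{k+1})$ for the integrator (with $q_k$ replaced by $\tilde q_k$ in (i)) and $\lambda_{k+1}$ for the discrete multiplier, one has $|q(t_k+\epsilon)-q_{k+1}|=O(\epsilon^{r+1})$, $|v(t_k+\epsilon)-v_{k+1}|=O(\epsilon^{l+1})$ with $\min(r,l)=p$, and $|\lambda(t_k+\epsilon)-\lambda_{k+1}|=O(\epsilon^{s+1})$ as $\epsilon\to0$,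 where $(q(t),v(t))$ solves the nonholonomic ODE above with $(q(t_k),v(t_k))=(q_k,v_k)$ and $\lambda(t)=\frac{v_x(t)v_y(t)}{1+y(t)^2}$. In (ii) the explicit vector field above is used also at points off $D^{np}$.
   Formalization: ''Does not preserve D^np'' in (ii) is read as in the parenthesis: for every ε>0 some generated pair violates v_z−y v_x=0 (points of D^np in the integrator's domain are in fact mapped into D^np); the discrete flow is taken as a partial map, defined where the equations have a unique solution. *)

(* Defs.v *)
From Stdlib Require Import Reals.
From Coquelicot Require Import Coquelicot.
Open Scope R_scope.

(* Coquelicot's norm on these products is the Euclidean one. *)
Definition vec3 : Type := (R * R * R)%type.

(* Used both for states (q, v) and for pairs of positions (q_k, q_{k+1}). *)
Definition vec3_pair : Type := (vec3 * vec3)%type.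

Definition vdist (a b : vec3) : R := norm (minus a b).

Definition nh_multiplier (w : vec3_pair) : R :=
  let '((_, y, _), (vx, vy, _)) := w in vx * vy / (1 + y ^ 2).

Definition nh_field (w : vec3_pair) : vec3_pair :=
  let '((_, y, _), (vx, vy, vz)) := w in
  ((vx, vy, vz),
   (- (y / (1 + y ^ 2)) * vx * vy, 0, / (1 + y ^ 2) * vx * vy)).

Definition nh_solution (a b : R) (w : R -> vec3_pair) : Prop :=
  forall t : R, a < t < b -> is_derive w t (nh_field (w t)).

Definition D_np (w : vec3_pair) : Prop :=
  let '((_, y, _), (vx, _, vz)) := w in vz - y * vx = 0.

Definition D_np_perturbed (eps : R) (w : vec3_pair) : Prop :=
  let '((_, y, _), (vx, vy, vz)) := w in
  vz - y * vx + eps / 2 * vx * vy = 0.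

Definition D_d (eps : R) (p : vec3_pair) : Prop :=
  let '((x0, y0, z0), (x1, y1, z1)) := p in
  (z1 - z0) / eps - (y1 + y0) / 2 * ((x1 - x0) / eps) = 0.

Definition discrete_nh_eqs (eps : R) (q0 q1 q2 : vec3) (lam : R) : Prop :=
  let '(x0, y0, z0) := q0 in
  let '(x1, y1, z1) := q1 in
  let '(x2, y2, z2) := q2 in
  (x2 - 2 * x1 + x0) / eps ^ 2 = - lam * y1 /\
  (y2 - 2 * y1 + y0) / eps ^ 2 = 0 /\
  (z2 - 2 * z1 + z0) / eps ^ 2 = lam /\
  (z2 - z1) / eps - (y2 + y1) / 2 * ((x2 - x1) / eps) = 0.

(* Graph of the discrete flow together with its multiplier.  For fixed eps the
   equations are not uniquely solvable at every point of D_d (they are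
   singular when 1 + y_k (3 y_k - y_{k-1}) / 2 = 0), so the flow is a partial
   map, defined where they determine (q_{k+1}, lambda_{k+1}) uniquely. *)
Definition discrete_nh_flow (eps : R) (p p' : vec3_pair) (lam : R) : Prop :=
  D_d eps p /\ fst p' = snd p /\
  unique (fun r : vec3 * R =>
            discrete_nh_eqs eps (fst p) (snd p) (fst r) (snd r))
         (snd p', lam).

Definition rho_tilde (eps : R) (p : vec3_pair) : vec3_pair :=
  (scal (/ 2) (plus (fst p) (snd p)), scal (/ eps) (minus (snd p) (fst p))).

Definition rho_hat (eps : R) (p : vec3_pair) : vec3_pair :=
  (snd p, scal (/ eps) (minus (snd p) (fst p))).

(* Graph of rho o F o rho^-1, with the multiplier of the step. *)
Definition velocity_integrator (rho : R -> vec3_pair -> vec3_pair)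
    (eps : R) (w w' : vec3_pair) (lam : R) : Prop :=
  exists p p' : vec3_pair,
    rho eps p = w /\ discrete_nh_flow eps p p' lam /\ rho eps p' = w'.

(* (p, s) consistency.  The states on which the integrator acts form the set
   rho eps (D_d eps), which may vary with eps, so the O(.) bounds are read as
   uniform over bounded sets of initial states; on such a set the integrator
   must be defined for all small eps. *)
Definition consistent_discretization (rho : R -> vec3_pair -> vec3_pair)
    (p s : nat) : Prop :=
  exists r l : nat, Nat.min r l = p /\
  forall M : R, exists C eps0 : R, 0 < eps0 /\
  forall eps : R, 0 < eps < eps0 ->
  forall p0 : vec3_pair, D_d eps p0 -> norm (rho eps p0) <= M ->
  exists (w' : vec3_pair) (lam : R),
    velocity_integrator rho eps (rho eps p0) w' lam /\
    forall (a b tk : R) (w : R -> vec3_pair),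
      a < tk -> tk + eps < b -> nh_solution a b w -> w tk = rho eps p0 ->
      vdist (fst (w (tk + eps))) (fst w') <= C * eps ^ (r + 1) /\
      vdist (snd (w (tk + eps))) (snd w') <= C * eps ^ (l + 1) /\
      Rabs (nh_multiplier (w (tk + eps)) - lam) <= C * eps ^ (s + 1).

Definition preserves (step : vec3_pair -> vec3_pair -> R -> Prop)
    (A : vec3_pair -> Prop) : Prop :=
  forall (w w' : vec3_pair) (lam : R), A w -> step w w' lam -> A w'.

(* Main.v *)
(* Substituting the equations of motion into the constraint at the new pair
   determines the multiplier as [lam = u c / E], where [u], [c] are the x- and
   y-velocities and [E] is an O(eps) perturbation of [1 + y ^ 2]; this makes one
   step an explicit rational map.  It is compared with the Taylor polynomials of
   the solution.  Remainders are uniform on bounded sets because [c] and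
   [u ^ 2 * (1 + y ^ 2)] are first integrals.  For [rho_tilde] the velocity errors
   of order eps ^ 2 cancel in the x-component, hence also in the z-component,
   since solution and integrator both satisfy [v = y u] with the same [y].  The
   preservation statements merely rewrite [D_d] in terms of position and velocity. *)

Require Import Defs.
From Stdlib Require Import Reals Lra.
From Coquelicot Require Import Coquelicot.
Open Scope R_scope.

(** * Derivatives and norms in product spaces *)

Lemma is_derive_fst (U V : NormedModule R_AbsRing) (f : R -> U * V) (t : R) (l : U * V) :
  is_derive f t l -> is_derive (fun s => fst (f s)) t (fst l).
Proof.
  intros H; eapply filterdiff_ext_lin.
  - apply (filterdiff_comp' f fst t _ fst H), filterdiff_linear, is_linear_fst.
  - reflexivity.
Qed.

Lemma is_derive_snd (U V : NormedModule R_AbsRing) (f : R -> U * V) (t : R) (l : U * V) :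
  is_derive f t l -> is_derive (fun s => snd (f s)) t (snd l).
Proof.
  intros H; eapply filterdiff_ext_lin.
  - apply (filterdiff_comp' f snd t _ snd H), filterdiff_linear, is_linear_snd.
  - reflexivity.
Qed.

Lemma norm_pair_le (U V : NormedModule R_AbsRing) (x : U) (y : V) :
  norm (x, y) <= norm x + norm y.
Proof.
  pose proof (norm_ge_0 x); pose proof (norm_ge_0 y).
  unfold norm at 1; simpl; unfold prod_norm; simpl.
  rewrite <- (sqrt_square (norm x + norm y)) by lra.
  apply sqrt_le_1_alt; nra.
Qed.

Lemma vdist_le (x y z x' y' z' : R) :
  vdist (x, y, z) (x', y', z') <= Rabs (x - x') + Rabs (y - y') + Rabs (z - z').
Proof.
  unfold vdist.
  change (minus (x, y, z) (x', y', z')) with ((x - x', y - y'), z - z').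
  eapply Rle_trans; [apply norm_pair_le | apply Rplus_le_compat_r, norm_pair_le].
Qed.

(** Only [y], [u] and [c] enter the error constants, so only these three are extracted. *)
Lemma norm_components_le (x y z u c v M : R) :
  norm (((x, y, z), (u, c, v)) : vec3_pair) <= M ->
  Rabs y <= M /\ Rabs u <= M /\ Rabs c <= M.
Proof.
  intros H.
  assert (Hf : forall (U V : NormedModule R_AbsRing) (p : U) (q : V) K,
             norm (p, q) <= K -> norm p <= K /\ norm q <= K).
  { intros U V p q K HK; pose proof (proj1 (norm_prod p q)).
    pose proof (Rmax_l (norm p) (norm q)); pose proof (Rmax_r (norm p) (norm q)); lra. }
  destruct (Hf _ _ _ _ _ H) as [Hq Hv].
  destruct (Hf _ _ _ _ _ Hq) as [Hxy _], (Hf _ _ _ _ _ Hv) as [Huc _].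
  destruct (Hf _ _ _ _ _ Hxy) as [_ Hy], (Hf _ _ _ _ _ Huc) as [Hu Hc].
  auto.
Qed.

(** * Taylor estimates with explicit remainder bounds *)

(** Matches the eta-expanded [Derive] terms that [auto_derive] produces. *)
Lemma Derive_eta (f : R -> R) (x l : R) : is_derive f x l -> Derive (fun s : R => f s) x = l.
Proof. exact (is_derive_unique f x l). Qed.

Lemma taylor1 (f f1 : R -> R) (t e K : R) :
  0 <= e ->
  (forall s, t <= s <= t + e -> is_derive f s (f1 s)) ->
  (forall s, t <= s <= t + e -> Rabs (f1 s) <= K) ->
  Rabs (f (t + e) - f t) <= K * e.
Proof.
  intros He Hf Hb.
  destruct (MVT_gen f t (t + e) f1) as [s [Hs E]];
    rewrite ?(Rmin_left t (t + e)), ?(Rmax_right t (t + e)) in * by lra.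
  - intros s Hs; apply Hf; lra.
  - intros s Hs; apply continuity_pt_filterlim, (ex_derive_continuous f).
    exists (f1 s); apply Hf; lra.
  - rewrite E, Rabs_mult; replace (t + e - t) with e by ring.
    rewrite (Rabs_pos_eq e) by lra.
    apply Rmult_le_compat_r; auto.
Qed.

(** Subtracting the tangent at [t] leaves a function with derivative [f1 s - f1 t], which [taylor1]
    bounds by [K * e]; a second use of [taylor1] gives the claim. The sharp factor 1/2 is given
    up. *)
Lemma taylor2 (f f1 f2 : R -> R) (t e K : R) :
  0 <= e ->
  (forall s, t <= s <= t + e -> is_derive f s (f1 s)) ->
  (forall s, t <= s <= t + e -> is_derive f1 s (f2 s)) ->
  (forall s, t <= s <= t + e -> Rabs (f2 s) <= K) ->
  Rabs (f (t + e) - (f t + e * f1 t)) <= K * e ^ 2.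
Proof.
  intros He Hf Hf1 Hb.
  pose proof (taylor1 (fun s => f s - (s - t) * f1 t) (fun s => f1 s - f1 t) t e (K * e)) as T.
  replace (f (t + e) - (f t + e * f1 t))
    with (f (t + e) - (t + e - t) * f1 t - (f t - (t - t) * f1 t)) by ring.
  replace (K * e ^ 2) with (K * e * e) by ring.
  apply T; [exact He | |].
  - intros s Hs; auto_derive; [exists (f1 s); auto |].
    rewrite (Derive_eta _ _ _ (Hf s Hs)); ring.
  - intros s Hs.
    assert (0 <= K) by (eapply Rle_trans; [apply Rabs_pos | apply (Hb s Hs)]).
    replace s with (t + (s - t)) by ring.
    apply Rle_trans with (K * (s - t)); [| apply Rmult_le_compat_l; lra].
    apply (taylor1 f1 f2); [lra | |]; intros r Hr; [apply Hf1 | apply Hb]; lra.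
Qed.

(** The same induction: after subtracting the quadratic Taylor polynomial, the derivative is the
    [taylor2] remainder of [f1]. *)
Lemma taylor3 (f f1 f2 f3 : R -> R) (t e K : R) :
  0 <= e ->
  (forall s, t <= s <= t + e -> is_derive f s (f1 s)) ->
  (forall s, t <= s <= t + e -> is_derive f1 s (f2 s)) ->
  (forall s, t <= s <= t + e -> is_derive f2 s (f3 s)) ->
  (forall s, t <= s <= t + e -> Rabs (f3 s) <= K) ->
  Rabs (f (t + e) - (f t + e * f1 t + e ^ 2 / 2 * f2 t)) <= K * e ^ 3.
Proof.
  intros He Hf Hf1 Hf2 Hb.
  pose proof (taylor1 (fun s => f s - (s - t) * f1 t - (s - t) ^ 2 / 2 * f2 t)
                (fun s => f1 s - (f1 t + (s - t) * f2 t)) t e (K * e ^ 2)) as T.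
  replace (f (t + e) - (f t + e * f1 t + e ^ 2 / 2 * f2 t))
    with (f (t + e) - (t + e - t) * f1 t - (t + e - t) ^ 2 / 2 * f2 t
          - (f t - (t - t) * f1 t - (t - t) ^ 2 / 2 * f2 t)) by field.
  replace (K * e ^ 3) with (K * e ^ 2 * e) by ring.
  apply T; [exact He | |].
  - intros s Hs; auto_derive; [exists (f1 s); auto |].
    rewrite (Derive_eta _ _ _ (Hf s Hs)); field.
  - intros s Hs.
    assert (0 <= K) by (eapply Rle_trans; [apply Rabs_pos | apply (Hb s Hs)]).
    replace (f1 s) with (f1 (t + (s - t))) by (f_equal; ring).
    apply Rle_trans with (K * (s - t) ^ 2);
      [| apply Rmult_le_compat_l; [lra | apply pow_incr; lra]].
    apply (taylor2 f1 f2 f3); [lra | | |]; intros r Hr;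
      [apply Hf1 | apply Hf2 | apply Hb]; lra.
Qed.

(** * The nonholonomic ODE in coordinates: time derivatives and first integrals *)

(* [u], [c], [v] are the three velocity components; [c] is constant in time. *)
Definition acc_x (y u c : R) : R := - (y / (1 + y ^ 2)) * u * c.
Definition acc_z (y u c : R) : R := / (1 + y ^ 2) * u * c.
(** [jerk_x], [jerk_z] and [snap_x] are the time derivatives of [acc_x], [acc_z] and [jerk_x] along
    solutions, reduced with u' = [acc_x], y' = c, c' = 0. Powers of [/ (1 + y ^ 2)] are kept as
    factors because each factor is at most 1. *)
Definition jerk_x (y u c : R) : R := - (1 - 2 * y ^ 2) * (/ (1 + y ^ 2)) ^ 2 * u * c ^ 2.
Definition jerk_z (y u c : R) : R := - 3 * y * (/ (1 + y ^ 2)) ^ 2 * u * c ^ 2.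
Definition snap_x (y u c : R) : R :=
  3 * y * (3 - 2 * y ^ 2) * (/ (1 + y ^ 2)) ^ 3 * u * c ^ 3.

(** The closed interval suits the Taylor estimates. The constraint is kept apart, since the second
    integrator starts from states off [D_np]. *)
Definition nh_ode (a b : R) (x y z u c v : R -> R) : Prop :=
  forall s, a <= s <= b ->
    is_derive x s (u s) /\ is_derive y s (c s) /\ is_derive z s (v s) /\
    is_derive u s (acc_x (y s) (u s) (c s)) /\ is_derive c s 0 /\
    is_derive v s (acc_z (y s) (u s) (c s)).

Lemma nh_solution_ode (a b t e : R) (w : R -> vec3_pair) :
  a < t -> t + e < b -> nh_solution a b w ->
  nh_ode t (t + e)
    (fun s => fst (fst (fst (w s)))) (fun s => snd (fst (fst (w s))))
    (fun s => snd (fst (w s)))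
    (fun s => fst (fst (snd (w s)))) (fun s => snd (fst (snd (w s))))
    (fun s => snd (snd (w s))).
Proof.
  intros Ha Hb Hw s Hs.
  assert (H : is_derive w s (nh_field (w s))) by (apply Hw; lra).
  pose proof (is_derive_fst _ _ _ _ _ H) as Hq.
  pose proof (is_derive_snd _ _ _ _ _ H) as Hv.
  pose proof (is_derive_fst _ _ _ _ _ (is_derive_fst _ _ _ _ _ Hq)) as Hx.
  pose proof (is_derive_snd _ _ _ _ _ (is_derive_fst _ _ _ _ _ Hq)) as Hy.
  pose proof (is_derive_snd _ _ _ _ _ Hq) as Hz.
  pose proof (is_derive_fst _ _ _ _ _ (is_derive_fst _ _ _ _ _ Hv)) as Hu.
  pose proof (is_derive_snd _ _ _ _ _ (is_derive_fst _ _ _ _ _ Hv)) as Hc.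
  pose proof (is_derive_snd _ _ _ _ _ Hv) as Hvz.
  clear H Hq Hv; unfold acc_x, acc_z.
  destruct (w s) as [[[x y] z] [[u c] v]]; simpl in *.
  exact (conj Hx (conj Hy (conj Hz (conj Hu (conj Hc Hvz))))).
Qed.

Lemma one_plus_sqr_pos (y : R) : 0 < 1 + y ^ 2.
Proof. pose proof (pow2_ge_0 y); lra. Qed.

Lemma is_derive_acc_x (a b : R) (x y z u c v : R -> R) (s : R) :
  nh_ode a b x y z u c v -> a <= s <= b ->
  is_derive (fun s => acc_x (y s) (u s) (c s)) s (jerk_x (y s) (u s) (c s)).
Proof.
  intros H Hs; destruct (H s Hs) as (_ & Hy & _ & Hu & Hc & _).
  pose proof (one_plus_sqr_pos (y s)).
  unfold acc_x at 1; auto_derive.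
  - repeat split; try (eexists; eassumption); simpl in *; lra.
  - rewrite (Derive_eta _ _ _ Hy), (Derive_eta _ _ _ Hu),
      (Derive_eta _ _ _ Hc).
    unfold acc_x, jerk_x; field; simpl in *; lra.
Qed.

Lemma is_derive_acc_z (a b : R) (x y z u c v : R -> R) (s : R) :
  nh_ode a b x y z u c v -> a <= s <= b ->
  is_derive (fun s => acc_z (y s) (u s) (c s)) s (jerk_z (y s) (u s) (c s)).
Proof.
  intros H Hs; destruct (H s Hs) as (_ & Hy & _ & Hu & Hc & _).
  pose proof (one_plus_sqr_pos (y s)).
  unfold acc_z at 1; auto_derive.
  - repeat split; try (eexists; eassumption); simpl in *; lra.
  - rewrite (Derive_eta _ _ _ Hy), (Derive_eta _ _ _ Hu),
      (Derive_eta _ _ _ Hc).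
    unfold acc_x, jerk_z; field; simpl in *; lra.
Qed.

Lemma is_derive_jerk_x (a b : R) (x y z u c v : R -> R) (s : R) :
  nh_ode a b x y z u c v -> a <= s <= b ->
  is_derive (fun s => jerk_x (y s) (u s) (c s)) s (snap_x (y s) (u s) (c s)).
Proof.
  intros H Hs; destruct (H s Hs) as (_ & Hy & _ & Hu & Hc & _).
  pose proof (one_plus_sqr_pos (y s)).
  unfold jerk_x at 1; auto_derive.
  - repeat split; try (eexists; eassumption); simpl in *; lra.
  - rewrite (Derive_eta _ _ _ Hy), (Derive_eta _ _ _ Hu),
      (Derive_eta _ _ _ Hc).
    unfold acc_x, snap_x; field; simpl in *; lra.
Qed.

Lemma derive_0_const (f : R -> R) (t e s : R) :
  (forall r, t <= r <= t + e -> is_derive f r 0) -> t <= s <= t + e -> f s = f t.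
Proof.
  intros Hf Hs.
  assert (H : Rabs (f (t + (s - t)) - f t) <= 0 * (s - t)).
  { apply (taylor1 f (fun _ => 0)); [lra | |]; intros r Hr.
    - apply Hf; lra.
    - rewrite Rabs_R0; lra. }
  replace (t + (s - t)) with s in H by ring.
  apply Rabs_le_between in H; lra.
Qed.

(* [u ^ 2 * (1 + y ^ 2)] is a first integral, which bounds [u] along solutions. *)
Lemma nh_ode_bounds (M t e : R) (x y z u c v : R -> R) :
  0 <= e <= 1 -> nh_ode t (t + e) x y z u c v ->
  Rabs (y t) <= M -> Rabs (u t) <= M -> Rabs (c t) <= M ->
  forall s, t <= s <= t + e ->
    Rabs (y s) <= 2 * (1 + M) ^ 2 /\ Rabs (u s) <= 2 * (1 + M) ^ 2 /\
    Rabs (c s) <= 2 * (1 + M) ^ 2.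
Proof.
  intros He H By Bu Bc s Hs.
  assert (HM : 0 <= M) by (eapply Rle_trans; [apply Rabs_pos | apply By]).
  (* The bound [2 * (1 + M) ^ 2] dominates at once 2 M (for [y]), M (1 + M) (for [u]) and M (for
     [c]). *)
  assert (HN : 0 <= M ^ 2 /\ 2 * (1 + M) ^ 2 = 2 + 4 * M + 2 * M ^ 2)
    by (split; [apply pow2_ge_0 | ring]).
  assert (Ec : forall r, t <= r <= t + e -> c r = c t).
  { intros r Hr; apply (derive_0_const c t e); [| lra].
    intros r' Hr'; apply (H r' Hr'). }
  assert (Dy : Rabs (y (t + (s - t)) - y t) <= M * (s - t)).
  { apply (taylor1 y c); [lra | |]; intros r Hr.
    - apply H; lra.
    - rewrite Ec by lra; exact Bc. }
  assert (E : u s ^ 2 * (1 + y s ^ 2) = u t ^ 2 * (1 + y t ^ 2)).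
  { apply (derive_0_const (fun r => u r ^ 2 * (1 + y r ^ 2)) t e); [| lra].
    intros r Hr; destruct (H r Hr) as (_ & Hy & _ & Hu & _ & _).
    pose proof (one_plus_sqr_pos (y r)).
    auto_derive.
    - repeat split; eexists; eassumption.
    - rewrite (Derive_eta _ _ _ Hy), (Derive_eta _ _ _ Hu).
      unfold acc_x; field; simpl in *; lra. }
  replace (t + (s - t)) with s in Dy by ring.
  repeat split.
  - pose proof (Rabs_triang_inv (y s) (y t)).
    assert (M * (s - t) <= M * 1) by (apply Rmult_le_compat_l; lra).
    lra.
  - assert (S : forall a, Rabs a <= M -> a ^ 2 <= M ^ 2).
    { intros a Ha; rewrite <- (pow2_abs a); apply pow_incr; split; [apply Rabs_pos | exact Ha]. }
    apply S in By, Bu.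
    (* As 1 + y^2 >= 1, the first integral gives u(s)^2 <= u(t)^2 (1 + y(t)^2) <= M^2 (1 + M^2) <=
       (M (1 + M))^2. *)
    apply Rle_trans with (M * (1 + M)); [| lra].
    apply Rsqr_incr_0; [| apply Rabs_pos | nra].
    rewrite <- Rsqr_abs; unfold Rsqr.
    pose proof (pow2_ge_0 (u s)); pose proof (pow2_ge_0 (y s)); pose proof (pow2_ge_0 (u t)).
    assert (u s * u s <= u t ^ 2 * (1 + y t ^ 2)) by nra.
    assert (u t ^ 2 * (1 + y t ^ 2) <= M ^ 2 * (1 + M ^ 2))
      by (apply Rmult_le_compat; try lra; pose proof (pow2_ge_0 (y t)); lra).
    nra.
  - rewrite Ec by lra; lra.
Qed.

(** v - y u is a first integral: its derivative is u c / (1 + y^2) - c u + y^2 u c / (1 + y^2) =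
    0. *)
Lemma nh_ode_constraint (t e : R) (x y z u c v : R -> R) :
  0 <= e -> nh_ode t (t + e) x y z u c v ->
  v t = y t * u t -> v (t + e) = y (t + e) * u (t + e).
Proof.
  intros He H E.
  assert (D : v (t + e) - y (t + e) * u (t + e) = v t - y t * u t); [| lra].
  apply (derive_0_const (fun r => v r - y r * u r) t e); [| lra].
  intros r Hr; destruct (H r Hr) as (_ & Hy & _ & Hu & _ & Hv).
  pose proof (one_plus_sqr_pos (y r)).
  auto_derive.
  - repeat split; eexists; eassumption.
  - rewrite (Derive_eta _ _ _ Hy), (Derive_eta _ _ _ Hu), (Derive_eta _ _ _ Hv).
    unfold acc_x, acc_z; field; simpl in *; lra.
Qed.

(** Both integrators reproduce these values exactly, so [y] and [c] contribute no error. *)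
Lemma nh_ode_y (t e : R) (x y z u c v : R -> R) :
  0 <= e -> nh_ode t (t + e) x y z u c v ->
  c (t + e) = c t /\ y (t + e) = y t + e * c t.
Proof.
  intros He H.
  assert (Ec : forall r, t <= r <= t + e -> c r = c t).
  { intros r Hr; apply (derive_0_const c t e); [| lra].
    intros r' Hr'; apply (H r' Hr'). }
  split; [apply Ec; lra |].
  assert (D : y (t + e) - (t + e) * c t = y t - t * c t); [| lra].
  apply (derive_0_const (fun r => y r - r * c t) t e); [| lra].
  intros r Hr; destruct (H r Hr) as (_ & Hy & _).
  auto_derive.
  - repeat split; eexists; eassumption.
  - rewrite (Derive_eta _ _ _ Hy), Ec by exact Hr; ring.
Qed.

(** * Bounds on absolute values of rational expressions *)

Lemma Rabs_plus_le (a b A B : R) : Rabs a <= A -> Rabs b <= B -> Rabs (a + b) <= A + B.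
Proof. intros; pose proof (Rabs_triang a b); lra. Qed.

Lemma Rabs_minus_le (a b A B : R) : Rabs a <= A -> Rabs b <= B -> Rabs (a - b) <= A + B.
Proof. intros; pose proof (Rabs_triang a (- b)); rewrite Rabs_Ropp in *; unfold Rminus; lra. Qed.

Lemma Rabs_opp_le (a A : R) : Rabs a <= A -> Rabs (- a) <= A.
Proof. now rewrite Rabs_Ropp. Qed.

Lemma Rabs_mult_le (a b A B : R) : Rabs a <= A -> Rabs b <= B -> Rabs (a * b) <= A * B.
Proof. intros; rewrite Rabs_mult; apply Rmult_le_compat; auto using Rabs_pos. Qed.

Lemma Rabs_pow_le (a A : R) (n : nat) : Rabs a <= A -> Rabs (a ^ n) <= A ^ n.
Proof. intros; rewrite <- RPow_abs; apply pow_incr; auto using Rabs_pos. Qed.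

Lemma Rabs_inv_le (E m : R) : 0 < m -> m <= E -> Rabs (/ E) <= / m.
Proof.
  intros Hm HE; rewrite Rabs_pos_eq.
  - now apply Rinv_le_contravar.
  - left; apply Rinv_0_lt_compat; lra.
Qed.

Lemma Rabs_inv_one_plus_sqr (y : R) : Rabs (/ (1 + y ^ 2)) <= / 1.
Proof. apply Rabs_inv_le; pose proof (pow2_ge_0 y); lra. Qed.

(* Bounds [Rabs] of an expression by the same expression in bounds of its atoms,
   so that an existential bound gets instantiated on the way. *)
Ltac bound_abs :=
  unfold Rdiv;
  repeat first
    [ eassumption
    | apply Rabs_inv_one_plus_sqr
    | apply Rabs_plus_le
    | apply Rabs_minus_le
    | apply Rabs_opp_le
    | apply Rabs_mult_le
    | apply Rabs_pow_le
    | apply Rle_refl ].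

Lemma derivatives_bounded (N : R) :
  exists Kax Kaz Kjx Kjz Ksx,
    forall y u c, Rabs y <= N -> Rabs u <= N -> Rabs c <= N ->
      Rabs (acc_x y u c) <= Kax /\ Rabs (acc_z y u c) <= Kaz /\
      Rabs (jerk_x y u c) <= Kjx /\ Rabs (jerk_z y u c) <= Kjz /\
      Rabs (snap_x y u c) <= Ksx.
Proof.
  (* The constants are created before [y], [u], [c] are introduced, hence can depend on [N] only. *)
  do 5 eexists; intros; unfold acc_x, acc_z, jerk_x, jerk_z, snap_x.
  repeat split; bound_abs.
Qed.

(** * One step of the discrete flow, solved explicitly *)

(* Eliminating the new position leaves [lam * E = u * c]. *)
Lemma discrete_nh_flow_step (e x y z u c v E lam : R) :
  0 < e -> E = 1 + y * (y + e * c / 2) -> E <> 0 ->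
  v = (y - e * c / 2) * u -> lam = u * c / E ->
  discrete_nh_flow e
    ((x - e * u, y - e * c, z - e * v), (x, y, z))
    ((x, y, z), (x + e * (u - e * y * lam), y + e * c, z + e * (v + e * lam))) lam.
Proof.
  intros He HE HE0 Hv Hlam.
  assert (Hmul : forall a b, a / e ^ 2 = b -> a = b * e ^ 2)
    by (intros a b <-; field; lra).
  assert (Ediv : lam * E = u * c) by (rewrite Hlam; field; exact HE0).
  rewrite HE in Ediv.
  split; [| split; [reflexivity | split]].
  - simpl; rewrite Hv; field; lra.
  - simpl; repeat split; try (field; lra).
    (* The hypothesis on [v] is the discrete constraint of the incoming pair. With it, the
       constraint defect of the outgoing pair becomes e (lam E - u c), which vanishes by the choice
       of [lam]. *)
    transitivity (v + e * lam - (y + e * c / 2) * (u - e * y * lam)); [field; lra |].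
    replace (v + e * lam - (y + e * c / 2) * (u - e * y * lam))
      with (v - (y + e * c / 2) * u + e * (lam * (1 + y * (y + e * c / 2)))) by ring.
    rewrite Ediv, Hv; field.
  (* Uniqueness: the difference equations express the new position through [lam']; the constraint
     then reads e E lam' = e u c, and e E is nonzero. *)
  - intros [[[x2 y2] z2] lam'] [Hx [Hy [Hz Hc]]]; cbn [fst snd] in *.
    apply Hmul in Hx, Hy, Hz.
    assert (Ex : x2 = x + e * (u - e * y * lam')) by lra.
    assert (Ey : y2 = y + e * c) by lra.
    assert (Ez : z2 = z + e * (v + e * lam')) by lra.
    enough (lam' = lam) by (subst; reflexivity).
    apply (Rmult_eq_reg_r (e * E)); [| apply Rmult_integral_contrapositive; lra].
    rewrite HE.
    replace (lam * (e * (1 + y * (y + e * c / 2)))) with (e * (u * c))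
      by (rewrite <- Ediv; ring).
    assert (Hc' : v + e * lam' - (y + e * c / 2) * (u - e * y * lam') = 0).
    { rewrite <- Hc, Ex, Ey, Ez; field; lra. }
    rewrite Hv in Hc'; lra.
Qed.

(** * The two velocity integrators in coordinates, and the constraints they respect *)

Lemma vec3_pair_ext (x y z u c v x' y' z' u' c' v' : R) :
  x = x' -> y = y' -> z = z' -> u = u' -> c = c' -> v = v' ->
  ((x, y, z), (u, c, v)) = ((x', y', z'), (u', c', v')) :> vec3_pair.
Proof. now intros -> -> -> -> -> ->. Qed.

Lemma rho_tilde_coord (e x0 y0 z0 x1 y1 z1 : R) :
  rho_tilde e ((x0, y0, z0), (x1, y1, z1)) =
  ((/ 2 * (x0 + x1), / 2 * (y0 + y1), / 2 * (z0 + z1)),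
   (/ e * (x1 - x0), / e * (y1 - y0), / e * (z1 - z0))).
Proof. reflexivity. Qed.

Lemma rho_hat_coord (e x0 y0 z0 x1 y1 z1 : R) :
  rho_hat e ((x0, y0, z0), (x1, y1, z1)) =
  ((x1, y1, z1), (/ e * (x1 - x0), / e * (y1 - y0), / e * (z1 - z0))).
Proof. reflexivity. Qed.

(** The midpoint value of y in the discrete constraint is exactly the y-coordinate of the base
    point. *)
Lemma rho_tilde_D_d (e : R) (p : vec3_pair) :
  0 < e -> D_d e p -> D_np (rho_tilde e p).
Proof.
  destruct p as [[[x0 y0] z0] [[x1 y1] z1]]; intros He H.
  rewrite rho_tilde_coord; simpl in *.
  rewrite <- H; field; lra.
Qed.

(** Relative to the base point [y1], the midpoint is y1 - (e/2) v_y; this shift produces the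
    perturbation term. *)
Lemma rho_hat_D_d (e : R) (p : vec3_pair) :
  0 < e -> D_d e p -> D_np_perturbed e (rho_hat e p).
Proof.
  destruct p as [[[x0 y0] z0] [[x1 y1] z1]]; intros He H.
  rewrite rho_hat_coord; simpl in *.
  rewrite <- H; field; lra.
Qed.

(** The last discrete equation is the constraint on the outgoing pair. *)
Lemma discrete_nh_flow_D_d (e : R) (p p' : vec3_pair) (lam : R) :
  discrete_nh_flow e p p' lam -> D_d e p'.
Proof.
  destruct p as [[[x0 y0] z0] [[x1 y1] z1]], p' as [[[x1' y1'] z1'] [[x2 y2] z2]].
  intros (_ & E & (_ & _ & _ & H) & _); simpl in *.
  now injection E as -> -> ->.
Qed.

Lemma rho_tilde_step (e x y z u c E lam : R) :
  0 < e -> E = 1 + (y + e * c / 2) * (y + e * c) -> E <> 0 -> lam = u * c / E ->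
  velocity_integrator rho_tilde e ((x, y, z), (u, c, y * u))
    ((x + e * u - e ^ 2 / 2 * ((y + e * c / 2) * lam), y + e * c,
      z + e * (y * u) + e ^ 2 / 2 * lam),
     (u - e * ((y + e * c / 2) * lam), c, (y + e * c) * (u - e * ((y + e * c / 2) * lam)))) lam.
Proof.
  intros He HE HE0 Hlam.
  assert (Ediv : lam * E = u * c) by (rewrite Hlam; field; exact HE0).
  rewrite HE in Ediv.
  (* The state is centred at the midpoint, so the point shared by the two pairs is half a step
     ahead; the denominator of the discrete flow at [y1] is then [E]. *)
  set (x1 := x + e * u / 2); set (y1 := y + e * c / 2); set (z1 := z + e * (y * u) / 2).
  exists ((x1 - e * u, y1 - e * c, z1 - e * (y * u)), (x1, y1, z1)).
  exists ((x1, y1, z1),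
          (x1 + e * (u - e * y1 * lam), y1 + e * c, z1 + e * (y * u + e * lam))).
  split; [| split].
  - rewrite rho_tilde_coord; unfold x1, y1, z1.
    apply vec3_pair_ext; field; lra.
  - apply discrete_nh_flow_step with (E := E); unfold y1; auto; try field.
    rewrite HE; field.
  - rewrite rho_tilde_coord; unfold x1, y1, z1.
    apply vec3_pair_ext; try (field; lra).
    (* The two forms of the new z-velocity differ by e (lam E - u c) = 0; the product form displays
       membership in [D_np]. *)
    transitivity (y * u + e * lam); [field; lra |].
    enough (e * (lam * (1 + (y + e * c / 2) * (y + e * c))) = e * (u * c)) by lra.
    now rewrite Ediv.
Qed.

Lemma rho_hat_step (e x y z u c v E lam : R) :
  0 < e -> E = 1 + y * (y + e * c / 2) -> E <> 0 ->
  v = (y - e * c / 2) * u -> lam = u * c / E ->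
  velocity_integrator rho_hat e ((x, y, z), (u, c, v))
    ((x + e * (u - e * y * lam), y + e * c, z + e * (v + e * lam)),
     (u - e * y * lam, c, v + e * lam)) lam.
Proof.
  intros He HE HE0 Hv Hlam.
  exists ((x - e * u, y - e * c, z - e * v), (x, y, z)).
  exists ((x, y, z), (x + e * (u - e * y * lam), y + e * c, z + e * (v + e * lam))).
  split; [| split].
  - rewrite rho_hat_coord; apply vec3_pair_ext; field; lra.
  - now apply discrete_nh_flow_step with (E := E).
  - rewrite rho_hat_coord; apply vec3_pair_ext; field; lra.
Qed.

Lemma preserves_rho_tilde (e : R) :
  0 < e -> preserves (velocity_integrator rho_tilde e) D_np.
Proof.
  intros He w w' lam _ (p & p' & _ & H & <-).
  apply rho_tilde_D_d; [exact He | exact (discrete_nh_flow_D_d _ _ _ _ H)].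
Qed.

Lemma preserves_rho_hat (e : R) :
  0 < e -> preserves (velocity_integrator rho_hat e) (D_np_perturbed e).
Proof.
  intros He w w' lam _ (p & p' & _ & H & <-).
  apply rho_hat_D_d; [exact He | exact (discrete_nh_flow_D_d _ _ _ _ H)].
Qed.

Lemma rho_hat_leaves_D_np (e : R) :
  0 < e -> exists (w w' : vec3_pair) (lam : R),
    velocity_integrator rho_hat e w w' lam /\ ~ D_np w'.
Proof.
  intros He; do 3 eexists; split.
  (* At y = 0 the denominator is 1, and u = c = 1 give v = -e/2 and lam = 1. The new state has y =
     e, u = 1, v = e/2, so v - y u = -e/2. *)
  - apply (rho_hat_step e 0 0 0 1 1 (- e / 2) 1 1); lra.
  - simpl; lra.
Qed.

(** * Local error of one step *)

(** Covers both denominators: k = 1, l = 1/2 for [rho_tilde] and k = 0, l = 1/2 for [rho_hat]. In 1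
    + y^2 + (k + l) e y c + k l (e c)^2 only the cross term can be negative, and it is at least -1/2
    because k + l <= 3/2 and e |y c| <= 1/3. *)
Lemma denominator_lower_bound (M e k l y c : R) :
  0 <= k <= 1 -> 0 <= l <= 1 / 2 -> 0 <= e <= / (3 * (1 + M ^ 2)) ->
  Rabs y <= M -> Rabs c <= M ->
  1 / 2 <= 1 + (y + k * (e * c)) * (y + l * (e * c)).
Proof.
  intros Hk Hl [He0 He] Hy Hc.
  assert (HM : 0 < 3 * (1 + M ^ 2)) by (pose proof (one_plus_sqr_pos M); lra).
  assert (B : Rabs (y * c) <= M ^ 2)
    by (replace (M ^ 2) with (M * M) by ring; now apply Rabs_mult_le).
  assert (He' : e * (3 * (1 + M ^ 2)) <= 1).
  { apply Rmult_le_compat_r with (r := 3 * (1 + M ^ 2)) in He; [| lra].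
    now rewrite Rinv_l in He by lra. }
  apply Rabs_le_between in B.
  assert (B' : - (1 / 3) <= e * (y * c)) by nra.
  assert (0 <= k * l * (e * c) ^ 2)
    by (apply Rmult_le_pos; [apply Rmult_le_pos; lra | apply pow2_ge_0]).
  pose proof (pow2_ge_0 y).
  assert ((k + l) * (e * (y * c)) >= - (1 / 2)) by nra.
  nra.
Qed.

Lemma Rabs_factor_le (a P b K : R) : a = P * b -> 0 <= b -> Rabs P <= K -> Rabs a <= K * b.
Proof.
  intros -> Hb HP; rewrite Rabs_mult, (Rabs_pos_eq b Hb).
  now apply Rmult_le_compat_r.
Qed.

(** Used with [a] the solution, [b] the integrator and [m] the Taylor polynomial between them. *)
Lemma Rabs_split_le (a b m K L d : R) :
  Rabs (a - m) <= K * d -> Rabs (m - b) <= L * d -> Rabs (a - b) <= (K + L) * d.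
Proof.
  intros; replace (a - b) with ((a - m) + (m - b)) by ring.
  rewrite Rmult_plus_distr_r; now apply Rabs_plus_le.
Qed.

Lemma rho_tilde_step_expansion (M : R) :
  exists Kx Kz Ku Kl, forall e x y z u c E lam,
    0 <= e <= 1 -> Rabs y <= M -> Rabs u <= M -> Rabs c <= M ->
    E = 1 + (y + e * c / 2) * (y + e * c) -> 1 / 2 <= E -> lam = u * c / E ->
    Rabs (x + e * u + e ^ 2 / 2 * acc_x y u c
          - (x + e * u - e ^ 2 / 2 * ((y + e * c / 2) * lam))) <= Kx * e ^ 3 /\
    Rabs (z + e * (y * u) + e ^ 2 / 2 * acc_z y u c
          - (z + e * (y * u) + e ^ 2 / 2 * lam)) <= Kz * e ^ 3 /\
    Rabs (u + e * acc_x y u c + e ^ 2 / 2 * jerk_x y u c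
          - (u - e * ((y + e * c / 2) * lam))) <= Ku * e ^ 3 /\
    Rabs (acc_z y u c - lam) <= Kl * e.
Proof.
  do 4 eexists; intros e x y z u c E lam He By Bu Bc HE HE2 Hlam.
  assert (Be : Rabs e <= 1) by (rewrite Rabs_pos_eq; lra).
  assert (BE : Rabs (/ E) <= / (1 / 2)) by (apply Rabs_inv_le; lra).
  pose proof (one_plus_sqr_pos y).
  assert (0 <= e ^ 3) by (apply pow_le; lra).
  assert (HE0 : 1 + (y + e * c / 2) * (y + e * c) <> 0) by lra.
  unfold acc_x, acc_z, jerk_x.
  repeat split.
  (* The cofactors [P] come from E - (1 + y^2) = e (3/2 y c + e c^2 / 2), which gives [acc_z - lam]
     an explicit factor e. *)
  - apply Rabs_factor_le with
      (P := / 2 * (c / 2 * u * c * / E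
                   - y * u * c * / (1 + y ^ 2) * (3 / 2 * y * c + e * c ^ 2 / 2) * / E));
      [subst; field; simpl in *; lra | assumption | bound_abs].
  - apply Rabs_factor_le with
      (P := / 2 * (u * c * / (1 + y ^ 2) * (3 / 2 * y * c + e * c ^ 2 / 2) * / E));
      [subst; field; simpl in *; lra | assumption | bound_abs].
  (* The e^2 terms cancel: (1 + y^2)/2 - 3/2 y^2 - (1 - 2 y^2)/2 = 0, the last summand coming from
     [jerk_x]. This is the gain of centring at the midpoint. *)
  - apply Rabs_factor_le with
      (P := u * c * (- c ^ 2 * y * (5 / 4 - y ^ 2) - e * c ^ 3 * (1 - 2 * y ^ 2) / 4)
            * (/ (1 + y ^ 2)) ^ 2 * / E);
      [subst; field; simpl in *; lra | assumption | bound_abs].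
  - apply Rabs_factor_le with
      (P := u * c * / (1 + y ^ 2) * (3 / 2 * y * c + e * c ^ 2 / 2) * / E);
      [subst; field; simpl in *; lra | lra | bound_abs].
Qed.

Lemma rho_hat_step_expansion (M : R) :
  exists Kx Kz Ku Kv Kl, forall e x y z u c v E lam,
    0 <= e <= 1 -> Rabs y <= M -> Rabs u <= M -> Rabs c <= M ->
    E = 1 + y * (y + e * c / 2) -> 1 / 2 <= E -> lam = u * c / E ->
    Rabs (x + e * u - (x + e * (u - e * y * lam))) <= Kx * e ^ 2 /\
    Rabs (z + e * v - (z + e * (v + e * lam))) <= Kz * e ^ 2 /\
    Rabs (u + e * acc_x y u c - (u - e * y * lam)) <= Ku * e ^ 2 /\
    Rabs (v + e * acc_z y u c - (v + e * lam)) <= Kv * e ^ 2 /\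
    Rabs (acc_z y u c - lam) <= Kl * e.
Proof.
  do 5 eexists; intros e x y z u c v E lam He By Bu Bc HE HE2 Hlam.
  assert (BE : Rabs (/ E) <= / (1 / 2)) by (apply Rabs_inv_le; lra).
  pose proof (one_plus_sqr_pos y).
  pose proof (pow2_ge_0 e).
  assert (HE0 : 1 + y * (y + e * c / 2) <> 0) by lra.
  unfold acc_x, acc_z.
  repeat split.
  (* Here E - (1 + y^2) = e y c / 2. The position errors are plain e^2 multiples of [lam]; the
     others inherit a factor e from [acc_z - lam]. *)
  - apply Rabs_factor_le with (P := y * (u * c * / E));
      [subst; field; simpl in *; lra | assumption | bound_abs].
  - apply Rabs_factor_le with (P := - (u * c * / E));
      [subst; field; simpl in *; lra | assumption | bound_abs].
  - apply Rabs_factor_le with (P := - y * (u * c * / (1 + y ^ 2) * (y * c / 2) * / E));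
      [subst; field; simpl in *; lra | assumption | bound_abs].
  - apply Rabs_factor_le with (P := u * c * / (1 + y ^ 2) * (y * c / 2) * / E);
      [subst; field; simpl in *; lra | assumption | bound_abs].
  - apply Rabs_factor_le with (P := u * c * / (1 + y ^ 2) * (y * c / 2) * / E);
      [subst; field; simpl in *; lra | lra | bound_abs].
Qed.

Lemma rho_tilde_local_error (M : R) :
  exists C, forall t e x y z u c v E lam,
    0 <= e <= 1 -> nh_ode t (t + e) x y z u c v ->
    Rabs (y t) <= M -> Rabs (u t) <= M -> Rabs (c t) <= M -> v t = y t * u t ->
    E = 1 + (y t + e * c t / 2) * (y t + e * c t) -> 1 / 2 <= E -> lam = u t * c t / E ->
    let u' := u t - e * ((y t + e * c t / 2) * lam) in
    vdist (x (t + e), y (t + e), z (t + e))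
      (x t + e * u t - e ^ 2 / 2 * ((y t + e * c t / 2) * lam), y t + e * c t,
       z t + e * (y t * u t) + e ^ 2 / 2 * lam) <= C * e ^ 3 /\
    vdist (u (t + e), c (t + e), v (t + e)) (u', c t, (y t + e * c t) * u') <= C * e ^ 3 /\
    Rabs (acc_z (y (t + e)) (u (t + e)) (c (t + e)) - lam) <= C * e.
Proof.
  set (N := 2 * (1 + M) ^ 2).
  destruct (derivatives_bounded N) as (Kax & Kaz & Kjx & Kjz & Ksx & HK).
  destruct (rho_tilde_step_expansion M) as (Kx & Kz & Ku & Kl & HD).
  (* The three entries serve position, velocity and multiplier; the factor [N] bounds [y] when the
     z-velocity error is deduced from that of [u]. *)
  exists (Rmax (Kjx + Kx + (Kjz + Kz)) (Rmax (Ksx + Ku + N * (Ksx + Ku)) (Kjz + Kl))).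
  intros t e x y z u c v E lam He H By Bu Bc Ev HE HE2 Hlam u'.
  pose proof (nh_ode_bounds M t e x y z u c v He H By Bu Bc) as HB; fold N in HB.
  destruct (nh_ode_y t e x y z u c v (proj1 He) H) as [Ec Ey].
  pose proof (nh_ode_constraint t e x y z u c v (proj1 He) H Ev) as Ev'.
  destruct (HD e (x t) (y t) (z t) (u t) (c t) E lam He By Bu Bc HE HE2 Hlam)
    as (Dx & Dz & Du & Dl); fold u' in Du.
  assert (Tx := taylor3 x u (fun s => acc_x (y s) (u s) (c s))
                 (fun s => jerk_x (y s) (u s) (c s)) t e Kjx (proj1 He)
                 ltac:(intros s Hs; apply H, Hs) ltac:(intros s Hs; apply H, Hs)
                 ltac:(intros s Hs; eapply is_derive_acc_x; eassumption)
                 ltac:(intros s Hs; apply HK; apply HB; assumption)).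
  assert (Tz := taylor3 z v (fun s => acc_z (y s) (u s) (c s))
                 (fun s => jerk_z (y s) (u s) (c s)) t e Kjz (proj1 He)
                 ltac:(intros s Hs; apply H, Hs) ltac:(intros s Hs; apply H, Hs)
                 ltac:(intros s Hs; eapply is_derive_acc_z; eassumption)
                 ltac:(intros s Hs; apply HK; apply HB; assumption)).
  assert (Tu := taylor3 u (fun s => acc_x (y s) (u s) (c s))
                 (fun s => jerk_x (y s) (u s) (c s))
                 (fun s => snap_x (y s) (u s) (c s)) t e Ksx (proj1 He)
                 ltac:(intros s Hs; apply H, Hs)
                 ltac:(intros s Hs; eapply is_derive_acc_x; eassumption)
                 ltac:(intros s Hs; eapply is_derive_jerk_x; eassumption)
                 ltac:(intros s Hs; apply HK; apply HB; assumption)).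
  assert (Tl := taylor1 (fun s => acc_z (y s) (u s) (c s))
                 (fun s => jerk_z (y s) (u s) (c s)) t e Kjz (proj1 He)
                 ltac:(intros s Hs; eapply is_derive_acc_z; eassumption)
                 ltac:(intros s Hs; apply HK; apply HB; assumption)).
  cbv beta in Tx, Tz, Tu, Tl; rewrite Ev in Tz.
  assert (0 <= e ^ 3) by (apply pow_le; lra).
  assert (Ax := Rabs_split_le _ _ _ _ _ _ Tx Dx).
  assert (Az := Rabs_split_le _ _ _ _ _ _ Tz Dz).
  assert (Au := Rabs_split_le _ _ _ _ _ _ Tu Du).
  assert (Al := Rabs_split_le _ _ _ _ _ _ Tl Dl).
  repeat split.
  - eapply Rle_trans; [apply vdist_le |].
    eapply Rle_trans; [| apply Rmult_le_compat_r; [assumption | apply Rmax_l]].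
    rewrite Ey, Rminus_diag, Rabs_R0; lra.
  - eapply Rle_trans; [apply vdist_le |].
    eapply Rle_trans; [| apply Rmult_le_compat_r;
                         [assumption | eapply Rle_trans; [apply Rmax_l | apply Rmax_r]]].
    rewrite Ec, Rminus_diag, Rabs_R0, Ev', Ey.
    rewrite <- Rmult_minus_distr_l.
    (* Both z-velocities equal y u at the common new [y], so no separate Taylor expansion of [v] is
       required. *)
    assert (Av : Rabs ((y t + e * c t) * (u (t + e) - u')) <= N * ((Ksx + Ku) * e ^ 3)).
    { apply Rabs_mult_le; [rewrite <- Ey; apply HB; lra | exact Au]. }
    lra.
  - eapply Rle_trans; [exact Al |].
    apply Rmult_le_compat_r; [lra | eapply Rle_trans; [apply Rmax_r | apply Rmax_r]].
Qed.

(** Solutions may start off [D_np] here, so [v] is not tied to y u and gets its own Taylor estimate;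
    all expansions of position and velocity stop one order earlier. *)
Lemma rho_hat_local_error (M : R) :
  exists C, forall t e x y z u c v E lam,
    0 <= e <= 1 -> nh_ode t (t + e) x y z u c v ->
    Rabs (y t) <= M -> Rabs (u t) <= M -> Rabs (c t) <= M ->
    E = 1 + y t * (y t + e * c t / 2) -> 1 / 2 <= E -> lam = u t * c t / E ->
    let u' := u t - e * y t * lam in
    let v' := v t + e * lam in
    vdist (x (t + e), y (t + e), z (t + e)) (x t + e * u', y t + e * c t, z t + e * v')
      <= C * e ^ 2 /\
    vdist (u (t + e), c (t + e), v (t + e)) (u', c t, v') <= C * e ^ 2 /\
    Rabs (acc_z (y (t + e)) (u (t + e)) (c (t + e)) - lam) <= C * e.
Proof.
  set (N := 2 * (1 + M) ^ 2).
  destruct (derivatives_bounded N) as (Kax & Kaz & Kjx & Kjz & Ksx & HK).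
  destruct (rho_hat_step_expansion M) as (Kx & Kz & Ku & Kv & Kl & HD).
  exists (Rmax (Kax + Kx + (Kaz + Kz)) (Rmax (Kjx + Ku + (Kjz + Kv)) (Kjz + Kl))).
  intros t e x y z u c v E lam He H By Bu Bc HE HE2 Hlam u' v'.
  pose proof (nh_ode_bounds M t e x y z u c v He H By Bu Bc) as HB; fold N in HB.
  destruct (nh_ode_y t e x y z u c v (proj1 He) H) as [Ec Ey].
  destruct (HD e (x t) (y t) (z t) (u t) (c t) (v t) E lam He By Bu Bc HE HE2 Hlam)
    as (Dx & Dz & Du & Dv & Dl); fold u' in Du, Dx; fold v' in Dv, Dz.
  assert (Tx := taylor2 x u (fun s => acc_x (y s) (u s) (c s)) t e Kax (proj1 He)
                 ltac:(intros s Hs; apply H, Hs) ltac:(intros s Hs; apply H, Hs)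
                 ltac:(intros s Hs; apply HK; apply HB; assumption)).
  assert (Tz := taylor2 z v (fun s => acc_z (y s) (u s) (c s)) t e Kaz (proj1 He)
                 ltac:(intros s Hs; apply H, Hs) ltac:(intros s Hs; apply H, Hs)
                 ltac:(intros s Hs; apply HK; apply HB; assumption)).
  assert (Tu := taylor2 u (fun s => acc_x (y s) (u s) (c s))
                 (fun s => jerk_x (y s) (u s) (c s)) t e Kjx (proj1 He)
                 ltac:(intros s Hs; apply H, Hs)
                 ltac:(intros s Hs; eapply is_derive_acc_x; eassumption)
                 ltac:(intros s Hs; apply HK; apply HB; assumption)).
  assert (Tv := taylor2 v (fun s => acc_z (y s) (u s) (c s))
                 (fun s => jerk_z (y s) (u s) (c s)) t e Kjz (proj1 He)
                 ltac:(intros s Hs; apply H, Hs)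
                 ltac:(intros s Hs; eapply is_derive_acc_z; eassumption)
                 ltac:(intros s Hs; apply HK; apply HB; assumption)).
  assert (Tl := taylor1 (fun s => acc_z (y s) (u s) (c s))
                 (fun s => jerk_z (y s) (u s) (c s)) t e Kjz (proj1 He)
                 ltac:(intros s Hs; eapply is_derive_acc_z; eassumption)
                 ltac:(intros s Hs; apply HK; apply HB; assumption)).
  cbv beta in Tx, Tz, Tu, Tv, Tl.
  assert (0 <= e ^ 2) by (apply pow_le; lra).
  assert (Ax := Rabs_split_le _ _ _ _ _ _ Tx Dx).
  assert (Az := Rabs_split_le _ _ _ _ _ _ Tz Dz).
  assert (Au := Rabs_split_le _ _ _ _ _ _ Tu Du).
  assert (Av := Rabs_split_le _ _ _ _ _ _ Tv Dv).
  assert (Al := Rabs_split_le _ _ _ _ _ _ Tl Dl).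
  repeat split.
  - eapply Rle_trans; [apply vdist_le |].
    eapply Rle_trans; [| apply Rmult_le_compat_r; [assumption | apply Rmax_l]].
    rewrite Ey, Rminus_diag, Rabs_R0; lra.
  - eapply Rle_trans; [apply vdist_le |].
    eapply Rle_trans; [| apply Rmult_le_compat_r;
                         [assumption | eapply Rle_trans; [apply Rmax_l | apply Rmax_r]]].
    rewrite Ec, Rminus_diag, Rabs_R0; lra.
  - eapply Rle_trans; [exact Al |].
    apply Rmult_le_compat_r; [lra | eapply Rle_trans; [apply Rmax_r | apply Rmax_r]].
Qed.

(** * Consistency orders and conclusion *)

(** The z-entry of the constraint form is 1, so the multiplier is the z-acceleration and [jerk_z]
    controls its variation. *)
Lemma nh_multiplier_acc_z (x y z u c v : R) :
  nh_multiplier ((x, y, z), (u, c, v)) = acc_z y u c.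
Proof. unfold nh_multiplier, acc_z, Rdiv; ring. Qed.

Lemma consistent_rho_tilde : consistent_discretization rho_tilde 2 0.
Proof.
  exists 2%nat, 2%nat; split; [reflexivity |]; intros M.
  destruct (rho_tilde_local_error M) as [C HC].
  pose proof (one_plus_sqr_pos M) as HM.
  (* This threshold keeps the denominator above 1/2 and is itself at most 1, as the local error
     bound demands. *)
  exists C, (/ (3 * (1 + M ^ 2))); split; [apply Rinv_0_lt_compat; lra |].
  intros e He p0 Hp Hn.
  assert (He1 : / (3 * (1 + M ^ 2)) <= / 1)
    by (apply Rinv_le_contravar; pose proof (pow2_ge_0 M); lra).
  rewrite Rinv_1 in He1.
  pose proof (rho_tilde_D_d e p0 (proj1 He) Hp) as Hv.
  destruct (rho_tilde e p0) as [[[x y] z] [[u c] v]].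
  destruct (norm_components_le _ _ _ _ _ _ _ Hn) as (By & Bu & Bc).
  simpl in Hv; assert (Ev : v = y * u) by lra; clear Hv; subst v.
  set (E := 1 + (y + e * c / 2) * (y + e * c)).
  assert (HE : 1 / 2 <= E).
  { replace E with (1 + (y + 1 * (e * c)) * (y + 1 / 2 * (e * c))) by (unfold E; field).
    apply denominator_lower_bound with M; auto; lra. }
  do 2 eexists; split; [apply (rho_tilde_step e x y z u c E (u * c / E)); auto; lra |].
  intros a b t w Ha Hb Hw Ew.
  pose proof (nh_solution_ode a b t e w Ha Hb Hw) as Hode.
  specialize (HC t e _ _ _ _ _ _ E (u * c / E) ltac:(lra) Hode).
  cbv beta in HC; rewrite Ew in HC; cbn [fst snd] in HC.
  specialize (HC By Bu Bc eq_refl eq_refl HE eq_refl).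
  destruct (w (t + e)) as [[[x' y'] z'] [[u' c'] v']].
  rewrite nh_multiplier_acc_z; cbn [fst snd Nat.add] in *; rewrite pow_1.
  exact HC.
Qed.

Lemma consistent_rho_hat : consistent_discretization rho_hat 1 0.
Proof.
  exists 1%nat, 1%nat; split; [reflexivity |]; intros M.
  destruct (rho_hat_local_error M) as [C HC].
  pose proof (one_plus_sqr_pos M) as HM.
  exists C, (/ (3 * (1 + M ^ 2))); split; [apply Rinv_0_lt_compat; lra |].
  intros e He p0 Hp Hn.
  assert (He1 : / (3 * (1 + M ^ 2)) <= / 1)
    by (apply Rinv_le_contravar; pose proof (pow2_ge_0 M); lra).
  rewrite Rinv_1 in He1.
  pose proof (rho_hat_D_d e p0 (proj1 He) Hp) as Hv.
  (* [Hv] is the perturbed constraint, equivalent to v = (y - e c / 2) u, the form that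
     [rho_hat_step] takes. *)
  destruct (rho_hat e p0) as [[[x y] z] [[u c] v]].
  destruct (norm_components_le _ _ _ _ _ _ _ Hn) as (By & Bu & Bc).
  simpl in Hv.
  set (E := 1 + y * (y + e * c / 2)).
  assert (HE : 1 / 2 <= E).
  { replace E with (1 + (y + 0 * (e * c)) * (y + 1 / 2 * (e * c))) by (unfold E; field).
    apply denominator_lower_bound with M; auto; lra. }
  do 2 eexists; split; [apply (rho_hat_step e x y z u c v E (u * c / E)); auto; lra |].
  intros a b t w Ha Hb Hw Ew.
  pose proof (nh_solution_ode a b t e w Ha Hb Hw) as Hode.
  specialize (HC t e _ _ _ _ _ _ E (u * c / E) ltac:(lra) Hode).
  cbv beta in HC; rewrite Ew in HC; cbn [fst snd] in HC.
  specialize (HC By Bu Bc eq_refl HE eq_refl).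
  destruct (w (t + e)) as [[[x' y'] z'] [[u' c'] v']].
  rewrite nh_multiplier_acc_z; cbn [fst snd Nat.add] in *; rewrite pow_1.
  exact HC.
Qed.

Theorem proposition6p3 :
  (consistent_discretization rho_tilde 2 0 /\
   forall eps : R, 0 < eps ->
     preserves (velocity_integrator rho_tilde eps) D_np) /\
  (consistent_discretization rho_hat 1 0 /\
   forall eps : R, 0 < eps ->
     (exists (w w' : vec3_pair) (lam : R),
        velocity_integrator rho_hat eps w w' lam /\ ~ D_np w') /\
     preserves (velocity_integrator rho_hat eps) (D_np_perturbed eps)).
Proof.
  repeat split.
  - exact consistent_rho_tilde.
  - exact preserves_rho_tilde.
  - exact consistent_rho_hat.
  - now apply rho_hat_leaves_D_np.
  - now apply preserves_rho_hat.
Qed.
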